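(* If $T$ is a tree of order $n\ge 3$ with diameter $d$, then $$\mathrm{aecc}_3(T)\ge \mathrm{aecc}_3(T'_{n,d}).$$
   Context: For a connected graph $G$ with $n(G)$ vertices and $S\subseteq V(G)$, the Steiner distance $d_G(S)$ is the minimum number of edges of a connected subgraph of $G$ containing $S$. For $v\in V(G)$, $\mathrm{ecc}_3(v,G)=\max\{d_G(S): v\in S\subseteq V(G), |S|=3\}$, and $\mathrm{aecc}_3(G)=\frac{1}{n(G)}\sum_{v\in V(G)}\mathrm{ecc}_3(v,G)$. For $d\ge 2$ and $n\ge d+1$, the tree $T'_{n,d}$ of order $n$ is obtained from the path $v_0v_1\ldots v_d$ by attaching $n-d-1$ pendent vertices as follows: if $d$ is even, all of them are attached to $v_{d/2}$; if $d$ is odd, $\lfloor (n-d-1)/2\rfloor$ of them are attached to $v_{\lfloor d/2\rfloor}$ and $\lceil (n-d-1)/2\rceil$ of them are attached to $v_{\lceil d/2\rceil}$. *)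

(* Defs.v *)
From mathcomp Require Import all_boot all_order all_algebra.

Set Implicit Arguments.
Unset Strict Implicit.
Unset Printing Implicit Defensive.

(* A finite simple graph is a symmetric irreflexive relation [e : rel V] on a
   finite type of vertices. *)
Section Graphs.
Variables (V : finType) (e : rel V).

Definition connected_graph : Prop := forall x y : V, connect e x y.

(* The bound 2 discards the closed walks x, y, x along a single edge. *)
Definition acyclic_graph : Prop :=
  forall c : seq V, cycle e c -> uniq c -> size c <= 2.

Definition is_tree : Prop :=
  [/\ symmetric e, irreflexive e, connected_graph & acyclic_graph].

(* Least length of a walk from [x] to [y]. In a connected graph that length is
   less than [#|V|]; if there is no walk the value is [#|V|] by convention. *)
Definition dist (x y : V) : nat :=
  find (fun k => [exists p : k.-tuple V, path e x p && (last x p == y)])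
       (iota 0 #|V|).

Definition diam : nat := \max_(x : V) \max_(y : V) dist x y.

Definition edges : {set {set V}} :=
  [set [set p.1; p.2] | p : V * V & e p.1 p.2].

(* [H = (W, F)] is the subgraph with vertex set [W] and edge set [F]. *)
Definition is_subgraph (H : {set V} * {set {set V}}) : bool :=
  (H.2 \subset edges) && [forall f in H.2, f \subset H.1].

Definition connected_subgraph (H : {set V} * {set {set V}}) : bool :=
  is_subgraph H &&
  [forall x in H.1, forall y in H.1, connect [rel u v | [set u; v] \in H.2] x y].

(* The default candidate, the whole graph, is admissible when the graph is
   connected, so the value is then a genuine minimum. *)
Definition steiner_dist (S : {set V}) : nat :=
  #|[arg min_(H < ([set: V], edges) | connected_subgraph H && (S \subset H.1))
       #|H.2| ].2|.

Definition ecc3 (v : V) : nat :=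
  \max_(S : {set V} | (v \in S) && (#|S| == 3)) steiner_dist S.

Definition aecc3 : rat := ((\sum_(v : V) (ecc3 v)%:R) / #|V|%:R)%R.

End Graphs.

(* In T'_{n,d} the vertices 0, ..., d form the path v_0 ... v_d and the vertices
   d+1, ..., n-1 are pendent; [pendent_nbr n d k] is the neighbour of the
   pendent vertex [k]. *)
Definition pendent_nbr (n d k : nat) : nat :=
  if odd d then
    if k - d.+1 < (n - d.+1)./2 then d./2 else uphalf d
  else d./2.

Definition Tprime_arc (n d u v : nat) : bool :=
  if v <= d then v == u.+1 else u == pendent_nbr n d v.

Definition Tprime (n d : nat) : rel 'I_n :=
  fun u v => Tprime_arc n d u v || Tprime_arc n d v u.

Arguments Tprime : clear implicits.

(* Main.v *)
(* Let P be a diametral path of T. Since T is acyclic, every connected subgraph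
   containing both ends of P contains all d edges of P, and one more edge if it
   also contains a vertex off P. Hence ecc3 is at least d everywhere and, unless
   T is a path, at least d + 1 outside the d - 1 inner vertices of P. In
   T'_{n,d} these bounds are attained: every vertex is inner on the path or
   adjacent to an inner vertex, so a triple S together with the d - 1 inner
   vertices spans a subtree. *)
Require Import Defs.
From mathcomp Require Import all_boot all_order all_algebra.
From mathcomp Require Import zify.

Set Implicit Arguments.
Unset Strict Implicit.
Unset Printing Implicit Defensive.

(** * Edges as unordered pairs, and a counting identity *)

Lemma in_edges (V : finType) (e : rel V) (u v : V) :
  symmetric e -> ([set u; v] \in edges e) = e u v.
Proof.
move=> e_sym; apply/imsetP/idP => [[[a b]] | euv]; last first.
  by exists (u, v); rewrite ?inE.
rewrite inE /= => eab uvE.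
have /set2P ua : u \in [set a; b] by rewrite -uvE set21.
have /set2P va : v \in [set a; b] by rewrite -uvE set22.
have /set2P au : a \in [set u; v] by rewrite uvE set21.
have /set2P bu : b \in [set u; v] by rewrite uvE set22.
by case: au => ?; case: bu => ?; case: ua => ?; case: va => ?; subst;
   rewrite // e_sym.
Qed.

(** Evaluates the pointwise bounds on [ecc3] for both trees: [A] is the set of inner vertices of the
    path and [b] records whether the tree is not a path. *)
Lemma sum_add_notin (T : finType) (A : {set T}) (m b : nat) :
  \sum_v (m + b * (v \notin A)) = #|T| * m + b * (#|T| - #|A|).
Proof.
rewrite big_split /= sum_nat_const -big_distrr /=.
have <- : #|~: A| = #|T| - #|A| by rewrite cardsCs setCK.
congr (_ + _ * _); rewrite -sum1_card [RHS]big_mkcond /=.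
by apply: eq_bigr => v _; rewrite inE; case: (v \in A).
Qed.

(** * Steiner distance and shortest paths in connected graphs *)

Section SteinerDistance.
Variables (V : finType) (e : rel V).
Hypothesis e_conn : connected_graph e.

(** Admissibility of the default candidate in [steiner_dist], which [arg_minnP] requires. *)
Lemma connected_subgraph_whole : connected_subgraph e ([set: V], edges e).
Proof.
apply/andP; split.
  by rewrite /is_subgraph subxx; apply/forall_inP => f _; apply: subsetT.
apply/forall_inP => x _; apply/forall_inP => y _.
apply: connect_sub (e_conn x y) => u v euv; apply: connect1 => /=.
by apply/imsetP; exists (u, v); rewrite ?inE.
Qed.

Lemma steiner_dist_le (S : {set V}) H :
  connected_subgraph e H -> S \subset H.1 -> steiner_dist e S <= #|H.2|.
Proof.
move=> Hconn SH; rewrite /steiner_dist; case: arg_minnP => [|K _]; last first.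
  by apply; rewrite Hconn.
by rewrite connected_subgraph_whole subsetT.
Qed.

Lemma steiner_dist_ge (S : {set V}) m :
  (forall H, connected_subgraph e H -> S \subset H.1 -> m <= #|H.2|) ->
  m <= steiner_dist e S.
Proof.
move=> m_le; rewrite /steiner_dist; case: arg_minnP => [|K /andP[? ?] _].
  by rewrite connected_subgraph_whole subsetT.
exact: m_le.
Qed.

Lemma shortest_path x y : exists p,
  [/\ path e x p, last x p = y, uniq (x :: p) & size p = dist e x y].
Proof.
pose P k := [exists p : k.-tuple V, path e x p && (last x p == y)].
have Psize p : path e x p -> last x p = y -> P (size p).
  by move=> ep lp; apply/existsP; exists (in_tuple p); rewrite ep lp /=.
(* A walk without repeated vertices has fewer than [#|V|] edges, so the search in [dist]
   succeeds. *)
have has_iota : has P (iota 0 #|V|).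
  have /connectP[q eq yq] := e_conn x y.
  case/shortenP: eq yq => q' eq' uq' _ yq.
  apply/hasP; exists (size q'); last exact: Psize.
  rewrite mem_iota /= add0n; have := max_card [in x :: q'].
  by rewrite (card_uniqP uq').
have lt_dist : dist e x y < #|V|.
  by rewrite -[#|V|](size_iota 0) -has_find.
have := nth_find 0 has_iota; rewrite nth_iota // add0n.
case/existsP => p /andP[ep /eqP yp].
(* Removing repetitions does not lengthen the walk, and [before_find] excludes anything shorter than
   [dist e x y]. *)
case/shortenP: ep (yp) => q eq uq sub_qp yq.
exists q; split=> //; apply/eqP; rewrite eqn_leq; apply/andP; split.
  rewrite -[dist e x y](size_tuple p); apply: uniq_leq_size => //.
  by case/andP: uq.
rewrite leqNgt; apply/negP => lt_q; have := before_find 0 lt_q.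
rewrite nth_iota ?(ltn_trans lt_q) // add0n => /negbT/negP; apply.
exact: (Psize q eq yq).
Qed.

Lemma diametral_path (x0 : V) :
  exists x p, [/\ path e x p, uniq (x :: p) & size p = diam e].
Proof.
pose x := [arg max_(x > x0) \max_y dist e x y].
pose y := [arg max_(y > x0) dist e x y].
have diamE : diam e = dist e x y.
  by rewrite /diam (bigmax_eq_arg x0) // (bigmax_eq_arg x0).
by have [p [ep _ up sp]] := shortest_path x y; exists x, p; rewrite diamE.
Qed.

End SteinerDistance.

(** * Lower bound for 3-eccentricities in a tree *)

Section TreeLowerBound.
Variables (V : finType) (e : rel V).
Hypothesis e_tree : is_tree e.

Let e_sym : symmetric e. Proof. by case: e_tree. Qed.
Let e_conn : connected_graph e. Proof. by case: e_tree. Qed.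

Lemma subgraph_edge H u v :
  connected_subgraph e H -> [set u; v] \in H.2 -> e u v.
Proof. by case/andP => /andP[/subsetP sub _] _ /sub; rewrite in_edges. Qed.

(* Without the edge [a b], going along the path from [a] back to [x], through
   [H] to the other end, and back along the path to [b] closes a cycle. *)
Lemma path_edge_in_subgraph H x p1 b p2 (a := last x p1) :
  connected_subgraph e H -> path e x (p1 ++ b :: p2) ->
  uniq (x :: p1 ++ b :: p2) -> x \in H.1 -> last b p2 \in H.1 ->
  [set a; b] \in H.2.
Proof.
move=> Hconn; rewrite cat_path -cat_cons cat_uniq /= => /and3P[ep1 eab ep2].
case/and3P=> _ /norP[bp1 p2p1] _ xH yH.
apply: contraT => abH.
pose e' := [rel u v | e u v && ([set u; v] != [set a; b])].
have e'_sym : connect_sym e'.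
  by apply: sym_connect_sym => u v; rewrite /= e_sym setUC.
(* A path that misses one end of the edge [a b] survives its deletion. *)
have e'_path z q c : c \in [set a; b] -> c \notin z :: q -> path e z q ->
    connect e' z (last z q).
  move=> cab czq ezq; apply/connectP; exists q => //.
  elim: q z czq ezq => //= w q IH z; rewrite inE negb_or => /andP[cz cwq].
  case/andP=> ezw ewq; rewrite IH // ezw andbT; apply/eqP => zwE.
  by move: cwq cab cz; rewrite -zwE !inE negb_or => /andP[/negPf-> _] /orP[]// ->.
have ap1 : a \in x :: p1 by exact: mem_last.
have abp2 : a \notin b :: p2.
  rewrite inE negb_or; apply/andP; split.
    by apply: contraNneq bp1 => <-.
  by apply: contra p2p1 => ap2; apply/hasP; exists a.
have xa : connect e' x a by apply: (e'_path _ _ b); rewrite ?set22.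
have by_ : connect e' b (last b p2) by apply: (e'_path _ _ a); rewrite ?set21.
have xy : connect e' x (last b p2).
  have /andP[_ /forall_inP/(_ _ xH)/forall_inP/(_ _ yH)] := Hconn.
  apply: connect_sub => u v /= uvH; apply: connect1 => /=.
  by rewrite (subgraph_edge Hconn uvH); apply: contraNneq abH => <-.
have /connectP[q] : connect e' a b.
  rewrite e'_sym in xa; rewrite e'_sym in by_.
  exact: connect_trans xa (connect_trans xy by_).
case/shortenP => {}q e'q uq _ bq.
have eq : path e a q by apply: sub_path e'q => u v /andP[].
have [_ _ _ /(_ (a :: q))] := e_tree.
rewrite /= rcons_path eq -bq e_sym eab => /(_ isT uq).
(* Acyclicity leaves at most one step from [a] to [b]: no step forces [a = b], and one step is the
   deleted edge. *)
case: q e'q bq {uq eq} => [|c [|//]] /=.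
  by move=> _ bE; move: abp2; rewrite bE mem_head.
by rewrite andbT => /andP[_ /eqP acab] bc; rewrite bc in acab.
Qed.

Section Path.
Variables (x : V) (p : seq V).
Hypotheses (ep : path e x p) (up : uniq (x :: p)).

Let edge (i : 'I_(size p)) := [set nth x (x :: p) i; nth x (x :: p) i.+1].

Lemma edge_inj : injective edge.
Proof.
move=> i j ijE; apply: val_inj => /=.
have nthE k l : k < (size p).+1 -> l < (size p).+1 ->
    (nth x (x :: p) k == nth x (x :: p) l) = (k == l).
  by move=> *; rewrite nth_uniq.
have iL := ltn_ord i; have jL := ltn_ord j.
have : nth x (x :: p) i \in edge j by rewrite -ijE set21.
have : nth x (x :: p) i.+1 \in edge j by rewrite -ijE set22.
by rewrite !inE !nthE; lia.
Qed.

(** All path edges lie in [H], and they are distinct by [edge_inj]. If [t] is off the path, [H] also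
    has an edge at [t]. *)
Lemma subgraph_edges_ge H t : connected_subgraph e H ->
  x \in H.1 -> last x p \in H.1 -> t \in H.1 ->
  size p + (t \notin x :: p) <= #|H.2|.
Proof.
move=> Hconn xH yH tH.
have sub : edge @: setT \subset H.2.
  apply/subsetP => f /imsetP[i _ ->]; rewrite /edge /=.
  have iL := ltn_ord i.
  have pE : p = take i p ++ nth x p i :: drop i.+1 p.
    by rewrite -drop_nth // cat_take_drop.
  have -> : nth x (x :: p) i = last x (take i p).
    by rewrite (last_nth x) size_takel ?(ltnW iL) //
         -[x :: take _ _]/(take i.+1 (x :: p)) nth_take.
  apply: (@path_edge_in_subgraph H x (take i p) _ (drop i.+1 p)); rewrite -?pE //.
  by move: yH; rewrite {1}pE last_cat.
have cardE : #|edge @: setT| = size p.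
  by rewrite card_imset ?cardsT ?card_ord //; apply: edge_inj.
have [tp | tp] := boolP (t \in x :: p).
  by rewrite addn0 -cardE subset_leq_card.
(* The first edge of a walk in [H] from [t] to [x] contains [t], so it is not a path edge. *)
have /andP[_ /forall_inP/(_ _ tH)/forall_inP/(_ _ xH)/connectP[[|u q]]] := Hconn.
  by move=> _ xt; rewrite xt mem_head in tp.
move=> /= /andP[tuH _] _.
rewrite -cardE addn1; apply: proper_card; rewrite properE sub.
apply/subsetPn; exists [set t; u] => //; apply/imsetP => -[i _ tuE].
have : t \in edge i by rewrite -tuE set21.
by case/set2P => tE; move: tp; rewrite tE mem_nth //= ltnS ?(ltnW (ltn_ord i)).
Qed.

Lemma ecc3_ge v t : 0 < size p -> t \notin [:: x; last x p] ->
  v \in [:: x; last x p; t] -> size p + (t \notin x :: p) <= ecc3 e v.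
Proof.
move=> p0; rewrite !inE => tS vS.
have xy : last x p != x.
  case: p p0 up => //= z q _ /andP[xq _].
  by apply: contraNneq xq => <-; apply: mem_last.
pose S := [set z in [:: t; last x p; x]].
have S3 : #|S| = 3.
  by rewrite cardsE; apply/card_uniqP; rewrite /= !inE orbC tS xy.
rewrite /ecc3 (bigD1 S) /=; last first.
  by rewrite S3 !inE; case/or3P: vS => ->; rewrite ?orbT.
apply: leq_trans (leq_maxl _ _).
apply: (steiner_dist_ge e_conn) => H Hconn /subsetP SH.
by apply: subgraph_edges_ge => //; apply: SH; rewrite !inE eqxx ?orbT.
Qed.
End Path.

Hypothesis V_ge3 : 2 < #|V|.

(** Otherwise any two distinct vertices would be adjacent, and three of them would form a
    triangle. *)
Lemma diam_ge2 : 1 < diam e.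
Proof.
rewrite ltnNge; apply/negP => diam1.
have adj u v : u != v -> e u v.
  move=> uv; have [[|w [|? ?]] [//= ew wv _ sp]] := shortest_path e_conn u v.
  - by rewrite wv eqxx in uv.
  - by rewrite -wv; case/andP: ew.
  have : dist e u v <= diam e.
    by apply: leq_trans (leq_bigmax u); apply: (leq_bigmax v).
  by rewrite -sp => /leq_trans /(_ diam1).
have /card_gt2P[x [y [z [_ [xy yz zx]]]]] : 2 < #|[set: V]| by rewrite cardsT.
have [_ _ _ /(_ [:: x; y; z])] := e_tree.
rewrite /= !adj //= !inE negb_or xy yz eq_sym zx => /(_ isT isT) //.
Qed.

Lemma diam_lt_card : diam e < #|V|.
Proof.
have /card_gt0P[x0 _] : 0 < #|V| by apply: leq_trans V_ge3.
have [x [p [_ up <-]]] := diametral_path e_conn x0.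
by have := max_card [in x :: p]; rewrite (card_uniqP up).
Qed.

Lemma sum_ecc3_ge : #|V| * diam e +
    (diam e < #|V|.-1) * (#|V| - (diam e).-1) <= \sum_v ecc3 e v.
Proof.
have /card_gt0P[x0 _] : 0 < #|V| by apply: leq_trans V_ge3.
have [x [p [ep up dE]]] := diametral_path e_conn x0.
have p0 : 0 < size p by rewrite dE ltnW ?diam_ge2.
(* The inner vertices: [p] already omits the start [x]. *)
pose I := [set z in p] :\ last x p.
have cardI : #|I| = (diam e).-1.
  have /andP[_ pu] := up.
  have := cardsD1 (last x p) [set z in p]; rewrite cardsE (card_uniqP pu) dE inE.
  suff -> : last x p \in p by rewrite -/I; lia.
  by rewrite -nth_last mem_nth // ltn_predL.
rewrite -cardI -sum_add_notin; apply: leq_sum => v _.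
(* A vertex [v] that is not an end of the path serves as the third vertex itself. *)
have [vS | vS] := boolP (v \in [:: x; last x p]); last first.
  rewrite -dE; apply: leq_trans (ecc3_ge ep up p0 vS _); last by rewrite !inE eqxx !orbT.
  rewrite leq_add2l; move: vS; rewrite /I !inE !negb_or => /andP[-> ->] /=.
  by case: (_ < _); rewrite ?mul1n.
(* For an end, the third vertex is taken off the path if the tree is not a path, and is any other
   vertex otherwise. *)
have [t tS tp] : exists2 t, t \notin [:: x; last x p] &
    (diam e < #|V|.-1) <= (t \notin x :: p).
  have [dV | _] := boolP (diam e < #|V|.-1).
    have /subsetPn[t _ tp] : ~~ ([set: V] \subset [set z in x :: p]).
      apply: contraTN dV => /subset_leq_card; rewrite cardsT cardsE (card_uniqP up) /= dE; lia.
    rewrite in_set in tp; exists t; rewrite ?tp //; apply: contra tp.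
    by rewrite inE => /orP[/eqP->|]; rewrite ?mem_head // inE => /eqP->; apply: mem_last.
  have /subsetPn[t _ tS] : ~~ ([set: V] \subset [set x; last x p]).
    apply/negP => /subset_leq_card; rewrite cardsT cards2; lia.
  by exists t; rewrite // !inE in tS *.
rewrite -dE; apply: leq_trans (ecc3_ge ep up p0 tS _).
  by rewrite leq_add2l dE; case: (v \notin I); rewrite ?muln1 ?muln0.
by move: vS; rewrite !inE => /orP[]->; rewrite ?orbT.
Qed.

End TreeLowerBound.

(** * Upper bound for 3-eccentricities in [Tprime n d] *)

Section TprimeUpperBound.
Variables n d : nat.
Hypotheses (d_ge2 : 1 < d) (d_ltn : d < n).

(* Parents in [Tprime n d] rooted at the vertex 1, which is inner as [1 < d];
   the value at 1 itself is irrelevant. *)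
Definition parent (k : nat) : nat :=
  if k is k'.+1 then if k <= d then k' else pendent_nbr n d k else 1.

(** Makes every vertex set containing the inner vertices closed under taking parents of non-root
    vertices, hence a subtree. *)
Lemma parent_interior k : k != 1 -> 0 < parent k < d.
Proof.
rewrite /parent /pendent_nbr; case: k => [|k] //=.
have dE := odd_double_half d; rewrite uphalf_half.
by case: (odd d) dE => /=; do ?case: ifP; lia.
Qed.

Lemma parent_ltn k : parent k < n.
Proof.
have [-> /= | /parent_interior] := eqVneq k 1; first by case: ifP; lia.
by lia.
Qed.

Definition parent_ord (v : 'I_n) : 'I_n := Ordinal (parent_ltn v).

Definition root_ord : 'I_n := Ordinal (ltn_trans d_ge2 d_ltn).

Lemma Tprime_sym : symmetric (Tprime n d).
Proof. by move=> u v; rewrite /Tprime orbC. Qed.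

Lemma Tprime_parent v : v != root_ord -> Tprime n d v (parent_ord v).
Proof.
rewrite -val_eqE /= /Tprime /Tprime_arc /parent /=.
case: (val v) => [|k] _ /=; first by rewrite ltnW.
by case: (k < d); rewrite eqxx orbT.
Qed.

Definition interior : {set 'I_n} := [set v : 'I_n | 0 < v < d].

Lemma parent_ord_interior v : v != root_ord -> parent_ord v \in interior.
Proof. by rewrite -val_eqE inE; apply: parent_interior. Qed.

Lemma card_interior : #|interior| = d.-1.
Proof.
have zero_n : 0 < n by lia.
have -> : interior = [set v : 'I_n | v < d] :\ Ordinal zero_n.
  by apply/setP => v; rewrite !inE -val_eqE /= lt0n.
have := cardsD1 (Ordinal zero_n) [set v : 'I_n | v < d].
rewrite inE /= (ltnW d_ge2) cardsE -sum1_card.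
rewrite -(big_ord_widen n (fun=> 1)) ?(ltnW d_ltn) // sum1_card card_ord.
by move/(congr1 predn)->.
Qed.

Definition spanned (S : {set 'I_n}) : {set 'I_n} * {set {set 'I_n}} :=
  (S :|: interior,
   [set [set v; parent_ord v] | v in (S :|: interior) :\ root_ord]).

Lemma spanned_connected S : connected_subgraph (Tprime n d) (spanned S).
Proof.
apply/andP; split.
  apply/andP; split.
    apply/subsetP => f /imsetP[v /setD1P[v1 _] ->].
    by apply/imsetP; exists (v, parent_ord v); rewrite ?inE //= Tprime_parent.
  apply/forall_inP => f /imsetP[v /setD1P[v1 vW] ->].
  by rewrite subUset !sub1set vW inE parent_ord_interior ?orbT.
set r := [rel u v | _].
have r_sym : connect_sym r.
  by apply: sym_connect_sym => u v; rewrite /= setUC.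
have r_parent v : v \in S :|: interior -> v != root_ord -> r v (parent_ord v).
  by move=> vW v1; apply/imsetP; exists v; rewrite // in_setD1 v1.
have int_root v : v \in interior -> connect r v root_ord.
  (* The parent of an inner vertex is its predecessor on the path, so the index decreases down to
     the root 1. *)
  have [k] := ubnP (val v); elim: k v => // k IH v; rewrite ltnS => vk vI.
  have [-> // | v1] := eqVneq v root_ord.
  apply: connect_trans (connect1 (r_parent v _ v1)) (IH _ _ _).
  - by rewrite inE vI orbT.
  - move: vI vk; rewrite inE /= /parent; case: (val v) => // j.
    by case: ifP; lia.
  - exact: parent_ord_interior.
have root v : v \in S :|: interior -> connect r v root_ord.
  move=> vW; have [-> // | v1] := eqVneq v root_ord.
  by apply: connect_trans (connect1 (r_parent v vW v1)) (int_root _ _);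
     apply: parent_ord_interior.
apply/forall_inP => u uW; apply/forall_inP => v vW.
by apply: connect_trans (root u uW) _; rewrite r_sym root.
Qed.

Lemma card_spanned S : #|(spanned S).2| < #|S :|: interior|.
Proof.
rewrite [#|S :|: _|](cardsD1 root_ord) !inE /= d_ge2 orbT add1n ltnS.
exact: leq_imset_card.
Qed.

Lemma Tprime_connected : connected_graph (Tprime n d).
Proof.
move=> u v; have /andP[/andP[/subsetP sub _]] := spanned_connected setT.
move=> /forall_inP/(_ u)/= ; rewrite !inE => /(_ isT)/forall_inP/(_ v).
rewrite !inE => /(_ isT); apply: connect_sub => a b /= /sub.
by rewrite in_edges; [apply: connect1 | apply: Tprime_sym].
Qed.

(** The subtree on [S] and the [d.-1] inner vertices has at most [d.+2] vertices, one fewer if [v]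
    is inner, and so at most [d.+1] or [d] edges. If [d = n.-1], the order [n] alone bounds the
    edges by [d]. *)
Lemma ecc3_Tprime_le v :
  ecc3 (Tprime n d) v <= d + (d < n.-1) * (v \notin interior).
Proof.
apply/bigmax_leqP => S /andP[vS /eqP S3].
apply: leq_trans (steiner_dist_le Tprime_connected (spanned_connected S) _) _.
  exact: subsetUl.
have := card_spanned S; have := subset_leq_card (subsetT (S :|: interior)).
have SI : (v \in interior) <= #|S :&: interior|.
  case: (boolP (v \in interior)) => // vI.
  by rewrite card_gt0; apply/set0Pn; exists v; rewrite inE vS.
rewrite cardsT card_ord cardsU S3 card_interior.
case: (v \in interior) SI => /=; case: (ltnP d n.-1).
all: move: #|_ :&: _| #|(spanned S).2| => a b; lia.
Qed.

Lemma sum_ecc3_Tprime_le :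
  \sum_v ecc3 (Tprime n d) v <= n * d + (d < n.-1) * (n - d.-1).
Proof.
have := sum_add_notin interior d (d < n.-1).
rewrite card_ord card_interior => <-.
by apply: leq_sum => v _; apply: ecc3_Tprime_le.
Qed.

End TprimeUpperBound.

Theorem theorem5p7 (V : finType) (e : rel V) (n d : nat)
    (Htree : is_tree e) (Hn : #|V| = n) (Hn3 : 3 <= n) (Hd : diam e = d) :
  (aecc3 (Tprime n d) <= aecc3 e)%R.
Proof.
subst n d.
(* Both averages have denominator [#|V|], so it remains to compare the sums as natural numbers. *)
rewrite /aecc3 card_ord Num.Theory.ler_wpM2r ?Num.Theory.invr_ge0 ?Num.Theory.ler0n //.
rewrite -!GRing.natr_sum Num.Theory.ler_nat.
have d_ge2 := diam_ge2 Htree Hn3; have d_lt := diam_lt_card Htree Hn3.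
exact: leq_trans (sum_ecc3_Tprime_le d_ge2 d_lt) (sum_ecc3_ge Htree Hn3).
Qed.
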